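(* Let $J$ be a finite set with $m:=|J|\ge2$ and let $\mathcal{Z}=(J,h,\boldsymbol g)$ be a uniform polymatroid with increment sequence $\boldsymbol g=(g_i)_{0\le i\le m}$ such that $g_{m-1}>0$. Then for every partition $\Pi=(P_x)_{x\in J}$ of a finite set $P$ of participants with $g_0<|P_x|$ for all $x\in J$, and every monotone increasing family $\Delta\subsetneq\mathcal{P}(J)$ such that $|\min\Delta|=1$, the access structure $\Gamma(\Pi,\mathcal{Z},\Delta)$ is ideal.
   Context: Polymatroids. For a finite set $J$ let $\mathcal{P}(J)$ be its power set. An (integer) polymatroid is a pair $(J,h)$ with $h:\mathcal{P}(J)\to\mathbb{N}_0$ such that $h(\emptyset)=0$, $h(X)\le h(Y)$ if $X\subseteq Y$, and $h(X\cap Y)+h(X\cup Y)\le h(X)+h(Y)$. It is uniform if $h(X)=h(Y)$ whenever $|X|=|Y|$; write $h_i=h(X)$ for $|X|=i$. With $m=|J|$, its increment sequence is $\boldsymbol g=(g_0,\dots,g_m)$, $g_i=h_{i+1}-h_i$ for $0\le i\le m-1$ and $g_m=0$; it is a nonincreasing sequence of nonnegative integers, and $g_0>0$ is assumed. Such a polymatroid is written $\mathcal{Z}=(J,h,\boldsymbol g)$. Monotone families. A monotone increasing family $\Delta$ is a nonempty family of subsets of $J$ closed under taking supersets in $J$ (being a proper subfamily of $\mathcal{P}(J)$, it does not contain $\emptyset$); $\min\Delta$ is the set of its inclusion-minimal members. Access structure. A partition $\Pi=(P_x)_{x\in J}$ of $P$ consists of pairwise disjoint nonempty sets (blocks) with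 union $P$. For $A\subseteq P$ put $\pi(A)=(|A\cap P_x|)_{x\in J}\in\mathbb{N}_0^J$. For $\bar v\in\mathbb{N}_0^J$ and $Y\subseteq J$ put $\mathrm{supp}(\bar v)=\{x:v_x\ne0\}$, $|\bar v|=\sum_{x\in J}v_x$, $|\bar v_Y|=\sum_{x\in Y}v_x$. For $X\subseteq J$ let $\mathcal{B}(\mathcal{Z},X)=\{\bar v\in\mathbb{N}_0^J:\mathrm{supp}(\bar v)\subseteq X,\ |\bar v|=h(X),\ |\bar v_Y|\le h(Y)\text{ for all }Y\subseteq X\}$. Then $\Gamma(\Pi,\mathcal{Z},\Delta)$ is the family of all $A\subseteq P$ such that $\pi(A)\ge\bar v$ (coordinatewise) for some $\bar v\in\bigcup_{X\in\Delta}\mathcal{B}(\mathcal{Z},X)$. Ideal access structures. A perfect secret sharing scheme with access structure $\Gamma\subseteq\mathcal{P}(P)$ consists of jointly distributed random variables $s_0$ (the secret) and $s_p$, $p\in P$ (the shares), with values in finite sets $S_0$ (with $|S_0|\ge2$) and $S_p$ respectively, every element of these sets being taken with positive probability, such that for $A\in\Gamma$ the shares $(s_p)_{p\in A}$ determine the secret $s_0$, and for $A\subseteq P$, $A\notin\Gamma$, the tuple $(s_p)_{p\in A}$ is independent of $s_0$ (reveals no information about the secret). The scheme is ideal if $|S_p|=|S_0|$ for all $p\in P$. The access structure $\Gamma$ is ideal if it is the access structure of some ideal perfect secret sharing scheme. *)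

(* Defs.v *)
From HB Require Import structures.
From mathcomp Require Import all_boot all_order all_algebra.
From mathcomp Require Import reals.

Set Implicit Arguments.
Unset Strict Implicit.
Unset Printing Implicit Defensive.

Import Order.TTheory GRing.Theory Num.Theory.
Local Open Scope nat_scope.

Definition polymatroid (J : finType) (h : {set J} -> nat) : Prop :=
  [/\ h set0 = 0,
      forall X Y : {set J}, X \subset Y -> h X <= h Y
    & forall X Y : {set J}, h (X :&: Y) + h (X :|: Y) <= h X + h Y].

Definition uniform_rank (J : finType) (h : {set J} -> nat) : Prop :=
  forall X Y : {set J}, #|X| = #|Y| -> h X = h Y.

(* The sequence is g 0, ..., g #|J|; later values of g are irrelevant. For a
   uniform polymatroid the subtraction h Y - h X below is never truncated. *)
Definition increment_sequence (J : finType) (h : {set J} -> nat)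
    (g : nat -> nat) : Prop :=
  (forall (i : nat) (X Y : {set J}),
     #|X| = i -> #|Y| = i.+1 -> g i = h Y - h X)
  /\ g #|J| = 0.

Definition uniform_polymatroid (J : finType) (h : {set J} -> nat)
    (g : nat -> nat) : Prop :=
  [/\ polymatroid h, uniform_rank h, increment_sequence h g & 0 < g 0].

Definition monotone_increasing (J : finType) (Delta : {set {set J}}) : Prop :=
  Delta != set0 /\
  forall X Y : {set J}, X \in Delta -> X \subset Y -> Y \in Delta.

Definition min_family (J : finType) (Delta : {set {set J}}) : {set {set J}} :=
  [set X | minset [in Delta] X].

Definition block_partition (J P : finType) (Pi : J -> {set P}) : Prop :=
  [/\ forall x : J, Pi x != set0,
      forall x y : J, x != y -> [disjoint Pi x & Pi y]
    & \bigcup_(x : J) Pi x = [set: P]].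

Definition block_profile (J P : finType) (Pi : J -> {set P}) (A : {set P}) :
    {ffun J -> nat} :=
  [ffun x => #|A :&: Pi x|].

Definition vweight (J : finType) (v : {ffun J -> nat}) (Y : {set J}) : nat :=
  \sum_(x in Y) v x.

Definition basis_vector (J : finType) (h : {set J} -> nat) (X : {set J})
    (v : {ffun J -> nat}) : Prop :=
  [/\ 0.-support v \subset X,
      vweight v [set: J] = h X
    & forall Y : {set J}, Y \subset X -> vweight v Y <= h Y].

Definition access_structure (J P : finType) (Pi : J -> {set P})
    (h : {set J} -> nat) (Delta : {set {set J}}) (A : {set P}) : Prop :=
  exists (X : {set J}) (v : {ffun J -> nat}),
    [/\ X \in Delta, basis_vector h X v & forall x : J, v x <= block_profile Pi A x].

Local Open Scope ring_scope.

Definition prob (R : realType) (outcome : finType) (law : outcome -> R)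
    (E : pred outcome) : R :=
  \sum_(w | E w) law w.

(* Finitely many random variables with finite ranges have a finitely supported
   joint law, so the underlying probability space is taken finite. *)
Record sharing_scheme (R : realType) (P : finType) := SharingScheme {
  outcome : finType;
  law : outcome -> R;
  secret_range : finType;
  share_range : P -> finType;
  secret : outcome -> secret_range;
  share : forall p : P, outcome -> share_range p;
  law_ge0 : forall w : outcome, 0 <= law w;
  law_sum1 : \sum_w law w = 1;
  secret_range_gt1 : (2 <= #|secret_range|)%N;
  secret_pos : forall a : secret_range, 0 < prob law (fun w => secret w == a);
  share_pos : forall (p : P) (b : share_range p),
    0 < prob law (fun w => share p w == b)
}.

Definition determines_secret (R : realType) (P : finType) (S : sharing_scheme R P)
    (A : {set P}) : Prop :=
  forall w w' : outcome S, 0 < law w -> 0 < law w' ->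
    (forall p : P, p \in A -> share p w = share p w') ->
    secret w = secret w'.

(* Every tuple of values indexed by A extends to a family b indexed by P, since
   all share ranges are nonempty. *)
Definition independent_of_secret (R : realType) (P : finType) (S : sharing_scheme R P)
    (A : {set P}) : Prop :=
  forall (a : secret_range S) (b : forall p : P, share_range S p),
    prob (@law R P S)
      (fun w => (secret w == a) && [forall p in A, share p w == b p])
    = prob (@law R P S) (fun w => secret w == a)
      * prob (@law R P S) (fun w => [forall p in A, share p w == b p]).

Definition perfect_for (R : realType) (P : finType) (S : sharing_scheme R P)
    (Gamma : {set P} -> Prop) : Prop :=
  (forall A : {set P}, Gamma A -> determines_secret S A) /\
  (forall A : {set P}, ~ Gamma A -> independent_of_secret S A).

Definition ideal_scheme (R : realType) (P : finType) (S : sharing_scheme R P) : Prop :=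
  forall p : P, #|share_range S p| = #|secret_range S|.

Definition ideal_access (R : realType) (P : finType) (Gamma : {set P} -> Prop) : Prop :=
  exists S : sharing_scheme R P, perfect_for S Gamma /\ ideal_scheme S.

(* Main.v *)
Require Import Defs.
From mathcomp Require Import all_boot all_order all_algebra all_field.
From mathcomp Require Import reals.

(** The polymatroid is realised by subspaces V_x of K^T, where K is a large finite
    field and T is the set of pairs (i, l) with l < g_i: with distinct points
    t_x of K, V_x is spanned by the vectors b_(x,l), l < g_0, whose entry
    at (i, l') is t_x^i if l' = l and 0 otherwise. The coordinates (i, 0) exist for
    all i < m because g_(m-1) > 0, so the m vectors b_(x,0) are independent and no
    b_(x,0) lies in the span of the V_y, y != x. If X0 is the minimal member of Delta,
    then s = sum_(x in X0) b_(x,0) lies in the span of (V_x)_(x in Y) if and only if X0 is a subset of Y.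

    Each participant p of block x gets a vector e_p in general position in V_x. The
    dimension of the span of the vectors of a coalition A, with or without s, is then
    given by a min formula of Rado type, from which s is in that span if and only if
    A is authorized. The scheme draws r uniformly, with secret r.s and shares
    r.e_p. *)
Set Implicit Arguments.
Unset Strict Implicit.
Unset Printing Implicit Defensive.
Import Order.TTheory GRing.Theory Num.Theory.
Local Open Scope ring_scope.

(** * Avoiding a few proper subspaces over a finite field *)

(** Each [V :&: U i] proper in [V] has at most [#|K| ^ (\dim V).-1] elements, so fewer than [#|K|]
    of them cannot cover [V]. *)
Lemma avoid_subspaces (K : finFieldType) (n : nat) (I : finType)
    (V : {vspace 'rV[K]_n}) (U : I -> {vspace 'rV[K]_n}) :
  (#|I| < #|K|)%N ->
  exists2 v, v \in V & forall i, v \in U i -> (V <= U i)%VS.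
Proof.
move=> ltIK.
have cardV (W : {vspace 'rV[K]_n}) : #|W| = (#|K| ^ \dim W)%N by exact: card_vspace.
case: (boolP [exists v, (v \in V) && [forall i, (v \in U i) ==> (V <= U i)%VS]]).
  by case/existsP=> v /andP[vV /forallP vU]; exists v => // i; apply/implyP.
move=> /existsPn noV.
pose bad i := ~~ (V <= U i)%VS.
have sub : [set v in V] \subset \bigcup_(i | bad i) [set v in (V :&: U i)%VS].
  apply/subsetP=> v; rewrite inE => vV.
  have := noV v; rewrite vV /= => /forallPn[i]; rewrite negb_imply => /andP[vU nV].
  by apply/bigcupP; exists i => //; rewrite inE memv_cap vV.
have := subset_leq_card sub; rewrite cardsE cardV.
have q1 : (1 < #|K|)%N by exact: finNzRing_gt1.
have bound i : bad i -> (#|[set v in (V :&: U i)%VS]| <= #|K| ^ (\dim V).-1)%N.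
  move=> badi; rewrite cardsE cardV leq_exp2l //.
  have lt : (\dim (V :&: U i) < \dim V)%N.
    by rewrite (ltn_leqif (dimv_leqif_sup (capvSl _ _))) subv_cap subvv.
  by rewrite -ltnS (leq_trans lt) // leqSpred.
have [i0 bi0|nobad] := pickP bad; last first.
  rewrite big_pred0 // cards0 leqn0 expn_eq0.
  by rewrite eqn0Ngt (leq_ltn_trans _ q1).
have dV : (0 < \dim V)%N.
  rewrite lt0n dimv_eq0; apply: contra bi0 => /eqP->; exact: sub0v.
suff : (#|\bigcup_(i | bad i) [set v in (V :&: U i)%VS]| < #|K| ^ \dim V)%N.
  by rewrite ltnNge => /negbTE->.
apply: (@leq_ltn_trans (\sum_(i | bad i) #|K| ^ (\dim V).-1)%N).
  apply: (@leq_trans (\sum_(i | bad i) #|[set v in (V :&: U i)%VS]|)%N); last exact: leq_sum.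
  elim/big_rec2: _ => [|i y1 y2 _ le]; first by rewrite cards0.
  by rewrite (leq_trans (leq_card_setU _ _)) // leq_add2l.
rewrite sum_nat_const -(prednK dV) /= expnS ltn_pmul2r ?expn_gt0 ?(ltnW q1) //.
exact: leq_ltn_trans (max_card _) ltIK.
Qed.


Lemma dim_sum_lines (K : fieldType) (vT : vectType K) (I : finType) (A : pred I)
    (e : I -> vT) :
  (\dim (\sum_(i in A) <[e i]>) <= #|A|)%N.
Proof.
apply: leq_trans (dimv_leq_sum _ _ _) _.
by rewrite -sum1_card leq_sum // => i _; rewrite dim_vline leq_b1.
Qed.

(** * Lagrange interpolation *)

Section Lagrange.
Variables (K : fieldType) (J : finType) (t : J -> K).
Hypothesis t_inj : injective t.

Definition lagrange_poly (Y : {set J}) (y : J) : {poly K} :=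
  (\prod_(z in Y :\ y) (t y - t z))^-1 *: \prod_(z in Y :\ y) ('X - (t z)%:P).

Lemma lagrange_poly_node (Y : {set J}) (y z : J) :
  z \in Y -> (lagrange_poly Y y).[t z] = (z == y)%:R.
Proof.
move=> zY; rewrite hornerZ horner_prod.
have [->|nzy] := eqVneq z y.
  under [X in _ * X]eq_bigr do rewrite hornerXsubC.
  rewrite mulVf //; apply/prodf_neq0 => u; rewrite !inE => /andP[nuy _].
  by rewrite subr_eq0 (inj_eq t_inj) eq_sym.
by rewrite [X in _ * X](bigD1 z) ?inE ?nzy //= hornerXsubC subrr mul0r mulr0.
Qed.

Lemma size_lagrange_poly (Y : {set J}) (y : J) :
  y \in Y -> (size (lagrange_poly Y y) <= #|Y|)%N.
Proof.
move=> yY; apply: leq_trans (size_scale_leq _ _) _.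
rewrite -big_enum /= -(big_map t predT (fun x => 'X - x%:P)).
by rewrite size_prod_XsubC size_map -cardE (cardsD1 y Y) yY.
Qed.

(** The difference of the two sides has size at most [#|Y|] but vanishes at the [#|Y|] distinct
    points [t y]. *)
Lemma lagrange_interpolation (Y : {set J}) (p : {poly K}) :
  (size p <= #|Y|)%N -> p = \sum_(y in Y) p.[t y] *: lagrange_poly Y y.
Proof.
move=> sp; apply/eqP; rewrite -subr_eq0; apply/eqP.
apply: (@roots_geq_poly_eq0 _ _ [seq t y | y <- enum Y]).
- apply/allP=> u /mapP[z]; rewrite mem_enum => zY ->.
  rewrite /root hornerD hornerN horner_sum (bigD1 z) //= hornerZ.
  rewrite lagrange_poly_node // eqxx mulr1 big1 ?addr0 ?subrr // => y /andP[yY nyz].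
  by rewrite hornerZ lagrange_poly_node // eq_sym (negbTE nyz) mulr0.
- by rewrite map_inj_uniq ?enum_uniq.
- rewrite size_map -cardE (leq_trans (size_polyD _ _)) // size_polyN geq_max sp /=.
  rewrite (leq_trans (size_sum _ _ _)) //; apply/bigmax_leqP => y yY.
  by rewrite (leq_trans (size_scale_leq _ _)) // size_lagrange_poly.
Qed.

End Lagrange.

(** * Representation of the polymatroid by moment vectors *)

Section Representation.
Variables (K : fieldType) (J : finType) (t : J -> K) (g : nat -> nat).
Hypothesis t_inj : injective t.
Hypothesis g_mono : forall i j, (i <= j < #|J|)%N -> (g j <= g i)%N.
Hypothesis g_last : (0 < g #|J|.-1)%N.

Let T : finType := {i : 'I_#|J| & 'I_(g i)}.

Let entry (d : 'I_#|T|) : {i : 'I_#|J| & 'I_(g i)} := @enum_val T T d.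

Definition moment_vector (x : J) (l : nat) : 'rV[K]_#|T| :=
  \row_d (t x ^+ tag (entry d) * (l == tagged (entry d) :> nat)%:R).

Let b := moment_vector.

Definition moment_space (x : J) : {vspace 'rV[K]_#|T|} :=
  (\sum_(l < g 0) <[moment_vector x l]>)%VS.

Let V (Y : {set J}) : {vspace 'rV[K]_#|T|} := (\sum_(x in Y) moment_space x)%VS.

Lemma moment_vector_mem (Y : {set J}) x l :
  x \in Y -> (l < g 0)%N -> b x l \in V Y.
Proof.
move=> xY lg; apply: (subvP (sumv_sup x xY (subvv _))).
by apply: (subvP (sumv_sup (Ordinal lg) isT (subvv _))); exact: memv_line.
Qed.

(* Lagrange interpolation through the points of Y expresses [b x l] in the [b y l]
   as soon as at most #|Y| coordinates (i, l) exist, i.e. g #|Y| <= l. *)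
Lemma moment_space_step (Y : {set J}) x :
  (moment_space x <= V Y + \sum_(l < g #|Y|) <[b x l]>)%VS.
Proof.
apply/subv_sumP => l _; rewrite -memvE.
have [lg|gl] := ltnP l (g #|Y|).
  apply: (subvP (addvSr _ _)).
  by apply: (subvP (sumv_sup (Ordinal lg) isT (subvv _))); exact: memv_line.
apply: (subvP (addvSl _ _)).
suff -> : moment_vector x l = \sum_(y in Y) (lagrange_poly t Y y).[t x] *: b y l.
  by apply: memv_suml => y yY; apply: memvZ; apply: moment_vector_mem.
apply/rowP=> d; rewrite summxE !mxE.
under eq_bigr do rewrite !mxE.
case: eqP => [le|_]; last first.
  by rewrite mulr0 big1 // => y _; rewrite !mulr0.
rewrite mulr1; under eq_bigr do rewrite mulr1 mulrC.
have iY : ((tag (entry d) : nat) < #|Y|)%N.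
  rewrite ltnNge; apply/negP => Yi.
  have := leq_trans (ltn_ord (tagged (entry d))) (@g_mono _ (tag (entry d)) _).
  by move=> /(_ #|Y|); rewrite Yi ltn_ord -le ltnNge gl => /(_ isT).
have sz : (size ('X^(tag (entry d)) : {poly K}) <= #|Y|)%N by rewrite size_polyXn.
have /= := congr1 (fun p => p.[t x]) (lagrange_interpolation t_inj sz).
rewrite hornerXn => ->.
by rewrite horner_sum; apply: eq_bigr => y _; rewrite hornerZ hornerXn.
Qed.

(** The coefficients of the Lagrange polynomials L_y invert the Vandermonde matrix: the coefficient
    of X^i in X^i' = sum_y t_y^i' L_y is 1 if i = i' and 0 otherwise. *)
Lemma moment_space_full : V [set: J] = fullv.
Proof.
apply/eqP; rewrite eqEsubv subvf /=; apply/subvP=> v _.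
rewrite [v]row_sum_delta; apply: memv_suml => d _; apply: memvZ.
set i := tag (entry d); set l := tagged (entry d).
have lg0 : (l < g 0)%N by rewrite (leq_trans (ltn_ord l)) // g_mono //= ltn_ord.
suff -> : delta_mx 0 d = \sum_(y in [set: J]) (lagrange_poly t [set: J] y)`_i *: b y l.
  by apply: memv_suml => y yY; apply: memvZ; apply: moment_vector_mem.
apply/rowP=> d'; rewrite summxE !mxE /=.
under eq_bigr do rewrite !mxE mulrA [_ * _ ^+ _]mulrC.
rewrite -mulr_suml.
have sz : (size ('X^(tag (entry d')) : {poly K}) <= #|[set: J]|)%N.
  by rewrite size_polyXn cardsT.
have /= := congr1 (fun p : {poly K} => p`_i) (lagrange_interpolation t_inj sz).
rewrite coefXn coef_sum.
rewrite [X in _ = X -> _](eq_bigr _ (fun y _ => coefZ _ _ _)).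
under [X in _ = X -> _]eq_bigr do rewrite hornerXn.
move=> <-; rewrite -natrM mulnb; congr (nat_of_bool _)%:R.
have -> : (d' == d) = (entry d' == entry d) by rewrite (inj_eq (@enum_val_inj T T)).
rewrite /l /i {l i lg0 sz}.
case: (entry d') => i1 l1; case: (entry d) => i2 l2 /=.
rewrite -tag_eqE /tag_eq /= eq_sym -val_eqE /=.
(* The second components have types depending on the first, so they are compared once the first ones
   are identified. *)
case: eqP => //= e; have {e} e := val_inj e; case: _ / e l1 => l1.
by rewrite tagged_asE eq_sym.
Qed.

Lemma dim_moment_sum_le (Y : {set J}) x (Z := x |: Y) :
  x \notin Y -> (\dim (V Z) <= \dim (V Y) + g #|Y|)%N.
Proof.
move=> xY; rewrite /V big_setU1 //=.
have le : (moment_space x + V Y <= V Y + \sum_(l < g #|Y|) <[b x l]>)%VS.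
  by rewrite subv_add moment_space_step addvSl.
apply: leq_trans (dimvS le) _; apply: leq_trans (dimv_add_leqif _ _) _.
by rewrite leq_add2l (leq_trans (dim_sum_lines _ _)) ?card_ord.
Qed.

(* Along a chain from set0 through Y to setT each step adds at most the next g i,
   while the total dimension is the full sum, so every step is an equality. *)
Lemma dim_moment_sum (Y : {set J}) : \dim (V Y) = (\sum_(i < #|Y|) g i)%N.
Proof.
pose H n := (\sum_(i < n) g i)%N.
(* This bounds dim V_B - dim V_A by H #|B| - H #|A|, rearranged to avoid truncated subtraction. *)
have step (A B : {set J}) : A \subset B -> (\dim (V B) + H #|A| <= \dim (V A) + H #|B|)%N.
  move=> sAB; have [k] := ubnP #|B :\: A|; elim: k B sAB => // k IHk B sAB.
  have [/eqP|[x]] := set_0Vmem (B :\: A).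
    rewrite setD_eq0 => sBA _; suff -> : B = A by [].
    by apply/eqP; rewrite eqEsubset sAB sBA.
  move=> xBA; move: (xBA); rewrite inE => /andP[xA xB].
  rewrite (cardsD1 x) xBA add1n ltnS => ltk.
  have sAB' : A \subset B :\ x by rewrite subsetD1 sAB xA.
  have xB' : x \notin B :\ x by rewrite !inE eqxx.
  have := IHk _ sAB'; rewrite setDDl setUC -setDDl => /(_ ltk) IH.
  have := dim_moment_sum_le xB'; rewrite setD1K // => le.
  rewrite (cardsD1 x B) xB add1n /H big_ord_recr /= -/(H _) addnA.
  rewrite (leq_trans (leq_add le (leqnn _))) // addnAC leq_add2r //.
have V0 : \dim (V set0) = 0%N by rewrite /V big_set0 dimv0.
have VT : \dim (V [set: J]) = H #|J|.
  rewrite moment_space_full dimvf dim_matrix mul1r card_tagged sumnE big_map.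
  by rewrite big_enum /=; apply: eq_bigr => i _; rewrite card_ord.
apply/eqP; rewrite eqn_leq; apply/andP; split.
  by have := step _ _ (sub0set Y); rewrite V0 cards0 /H big_ord0 addn0 add0n.
by have := step _ _ (subsetT Y); rewrite VT cardsT addnC leq_add2r.
Qed.

(** If x in X0 lies outside Y, cancelling the other terms puts b_(x,0) in the span U of all V_y with
    y != x. Then V_x adds fewer than g_(m-1) dimensions to U, against the dimension formula. *)
Lemma moment_sum_secret (X0 Y : {set J}) :
  (\sum_(x in X0) b x 0 \in V Y) = (X0 \subset Y).
Proof.
(* For empty [J] the predecessor of 0 is 0, and [g_last] is the claim itself. *)
have g0 : (0 < g 0)%N.
  case: (posnP #|J|) g_last => [->//|J0 /leq_trans-> //].
  by rewrite g_mono //= prednK.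
apply/idP/idP=> [sY|/subsetP sXY]; last first.
  by apply: memv_suml => x xX; apply: moment_vector_mem; rewrite ?sXY.
apply/subsetP=> x xX; apply/negPn/negP => xY.
pose U := V ([set: J] :\ x).
have bU : b x 0 \in U.
  have : \sum_(x in X0) b x 0 \in U.
    apply: (subvP _ _ sY); apply/subv_sumP => y yY; apply: sumv_sup (subvv _).
    by rewrite !inE andbT; apply: contraNneq xY => <-.
  rewrite (bigD1 x) //= => sU; rewrite -(addrK (\sum_(i in X0 | i != x) b i 0) (b x 0)).
  apply: memvB => //; apply: memv_suml => y /andP[yX nyx].
  by apply: moment_vector_mem; rewrite // !inE nyx.
have Jx : #|[set: J] :\ x| = #|J|.-1 by rewrite -cardsT (cardsD1 x [set: J]) inE.
have J0 : (0 < #|J|)%N by apply/card_gt0P; exists x.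
have := moment_space_step ([set: J] :\ x) x; rewrite -/U Jx -/b.
(* Of the g_(m-1) = k + 1 lines that could extend [U], the one with l = 0 already lies in it, which
   leaves k. *)
case eg : (g #|J|.-1) g_last => [//|k] _; rewrite big_ord_recl /= addvA.
have -> : (U + <[b x 0]> = U)%VS by apply/addv_idPl; rewrite -memvE.
move=> le.
have : (fullv <= U + \sum_(i < k) <[b x (bump 0 i)]>)%VS.
  by rewrite -moment_space_full /V (big_setD1 x) ?inE //= subv_add le addvSl.
move=> /dimvS /leq_trans/(_ (dimv_add_leqif _ _)).
rewrite -moment_space_full !dim_moment_sum Jx cardsT.
have -> : (\sum_(i < #|J|) g i = \sum_(i < #|J|.-1) g i + k.+1)%N.
  by case: #|J| J0 eg => [//|m] _ /= <-; rewrite big_ord_recr.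
rewrite leq_add2l ltnNge => /negP; apply.
by rewrite (leq_trans (dim_sum_lines _ _)) ?card_ord.
Qed.

End Representation.

(** * Vectors in general position *)

Section Generic.
Variables (K : finFieldType) (n : nat) (J P I : finType) (blk : P -> J).
Variables (V : J -> {vspace 'rV[K]_n}) (F : I -> {vspace 'rV[K]_n}).

(* The vectors are chosen one at a time, e p outside every subspace
   (sum of some V x) + F i + (span of some earlier vectors) that does not contain
   V (blk p). *)
Lemma generic_vectors :
  (#|{: {set J} * {set P} * I}| < #|K|)%N ->
  exists e : P -> 'rV[K]_n,
    (forall p, e p \in V (blk p)) /\
    forall (S : {set P}) (Y : {set J}) (i : I),
    exists2 Z : {set J}, Y \subset Z &
      \dim (\sum_(x in Y) V x + F i + \sum_(p in S) <[e p]>) =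
      (\dim (\sum_(x in Z) V x + F i) + #|[set p in S | blk p \notin Z]|)%N.
Proof.
move=> ltK.
(* The induction runs over a list of treated participants, so the formula is claimed only for sets
   [S] inside it. *)
suff [e [eV eP]] : exists e : P -> 'rV[K]_n,
    (forall p, e p \in V (blk p)) /\
    forall (S : {set P}) (Y : {set J}) (i : I), {subset S <= enum P} ->
    exists2 Z : {set J}, Y \subset Z &
      \dim (\sum_(x in Y) V x + F i + \sum_(p in S) <[e p]>) =
      (\dim (\sum_(x in Z) V x + F i) + #|[set p in S | blk p \notin Z]|)%N.
  by exists e; split=> // S Y i; apply: eP => p _; rewrite mem_enum.
elim: (enum P) => [|p s [e [eV IH]]].
  exists (fun=> 0); split=> [p|S Y i S0]; first exact: mem0v.
  exists Y => //; have -> : S = set0.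
    by apply/setP=> p; rewrite inE; apply: contraTF isT => /S0.
  rewrite big_set0 addv0; have -> : [set p in set0 | blk p \notin Y] = set0.
    by apply/setP=> p; rewrite !inE.
  by rewrite cards0 addn0.
have [ps|ps] := boolP (p \in s).
  exists e; split=> // S Y i sS; apply: IH => q /sS; rewrite inE => /predU1P[->|] //.
have [v vV vP] := avoid_subspaces (V (blk p)) (fun u : {set J} * {set P} * I =>
  \sum_(x in u.1.1) V x + F u.2 + \sum_(q in u.1.2) <[e q]>)%VS ltK.
exists (fun q => if q == p then v else e q); split=> [q|S Y i sS].
  by case: eqP => // ->.
pose S' := S :\ p.
have eS : (\sum_(q in S') <[if q == p then v else e q]> = \sum_(q in S') <[e q]>)%VS.
  by apply: eq_bigr => q; rewrite !inE => /andP[/negbTE->].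
have sS' : {subset S' <= s}.
  by move=> q; rewrite !inE => /andP[nqp /sS]; rewrite inE (negbTE nqp).
have [pS|pS] := boolP (p \in S); last first.
  have eSS : S = S' by apply/esym/setDidPl; rewrite disjoint_sym disjoints1.
  by rewrite eSS eS; apply: IH.
rewrite (big_setD1 p pS) /= eqxx eS.
have -> : (\sum_(x in Y) V x + F i + (<[v]> + \sum_(q in S') <[e q]>) =
   <[v]> + (\sum_(x in Y) V x + F i + \sum_(q in S') <[e q]>))%VS.
  by rewrite (addvA _ <[v]>%VS) (addvC _ <[v]>%VS) -(addvA <[v]>%VS).
set W := (\sum_(x in Y) V x + F i + \sum_(q in S') <[e q]>)%VS.
set x := blk p in vV vP.
have VxY : (\sum_(y in x |: Y) V y = V x + \sum_(y in Y) V y)%VS.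
  apply/eqP; rewrite eqEsubv subv_add; apply/and3P; split.
  - apply/subv_sumP => y; rewrite !inE => /predU1P[->|yY]; first exact: addvSl.
    by apply: subv_trans (addvSr _ _); apply: sumv_sup (subvv _).
  - by apply: sumv_sup (subvv _); rewrite !inE eqxx.
  - by apply/subv_sumP => y yY; apply: sumv_sup (subvv _); rewrite !inE yY orbT.
have WxY : (\sum_(y in x |: Y) V y + F i + \sum_(q in S') <[e q]> = V x + W)%VS.
  by rewrite VxY /W !addvA.
have cS (Z : {set J}) : #|[set q in S | blk q \notin Z]| =
    ((x \notin Z) + #|[set q in S' | blk q \notin Z]|)%N.
  rewrite (cardsD1 p) !inE pS /= -/x; congr (_ + #|pred_of_set _|)%N.
  by apply/setP=> q; rewrite !inE andbA.
(* If [v] falls in [W], its choice forces [V x] inside [W], so [x] can join [Y] without changing the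
   space. *)
have [vW|vW] := boolP (v \in W).
  have VW : (V x <= W)%VS by exact: (vP (Y, S', i)).
  have [Z sZ dZ] := IH S' (x |: Y) i sS'.
  exists Z; first by apply: subset_trans sZ; exact: subsetUr.
  have xZ : x \in Z by apply: (subsetP sZ); rewrite !inE eqxx.
  rewrite cS xZ -dZ WxY (addv_idPr VW).
  by have /addv_idPr-> : (<[v]> <= W)%VS by rewrite -memvE.
have dW : \dim (<[v]> + W) = (\dim W).+1.
  rewrite dimv_disjoint_sum.
    by rewrite dim_vline; case: eqP vW => // ->; rewrite mem0v.
  apply/eqP; rewrite -subv0; apply/subvP=> u; rewrite memv_cap => /andP[/vlineP[k ->] kW].
  case: (eqVneq k 0) => [->|k0]; first by rewrite scale0r mem0v.
  by case/negP: vW; rewrite -[v](scalerK k0) memvZ.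
have [Z sZ dZ] := IH S' Y i sS'.
exists Z => //; rewrite dW -/W dZ cS.
(* If [x] were in [Z], the sum of the [V y] over [Z], [F i] and the lines outside [Z] would contain
   [<[v]> + W], yet its dimension is at most that of [W]. *)
have [xZ|//] := boolP (x \in Z); last by rewrite addnS.
have : (<[v]> + W <=
    \sum_(y in Z) V y + F i + \sum_(q in [set q in S' | blk q \notin Z]) <[e q]>)%VS.
  rewrite /W !subv_add -!memvE -!andbA; apply/and4P; split.
  - apply: (subvP _ _ vV); rewrite -addvA; apply: subv_trans (addvSl _ _).
    by apply: sumv_sup (subvv _).
  - apply/subv_sumP => y yY; rewrite -addvA; apply: subv_trans (addvSl _ _).
    by apply: sumv_sup (subvv _); exact: (subsetP sZ).
  - by apply: subv_trans (addvSl _ _); exact: addvSr.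
  apply/subv_sumP => q qS; have [qZ|qZ] := boolP (blk q \in Z).
    rewrite -memvE; apply: (subvP _ _ (eV q)); rewrite -addvA; apply: subv_trans (addvSl _ _).
    exact: (sumv_sup _ qZ (subvv _)).
  apply: subv_trans (addvSr _ _); apply: (sumv_sup q) => //.
  by rewrite inE qZ andbT; move: qS; rewrite inE.
move/dimvS; rewrite dW dZ => /leq_trans/(_ (dimv_add_leqif _ _)).
rewrite ltnNge => /negP[]; rewrite leq_add2l.
exact: dim_sum_lines.
Qed.
End Generic.

(** * The linear secret sharing scheme *)

Section Scheme.
Variables (R : realType) (K : finFieldType) (n : nat) (P : finType).
Variables (e : P -> 'rV[K]_n) (s : 'rV[K]_n).

Let dot (w v : 'rV[K]_n) : K := (w *m v^T) 0 0.

Lemma dotDl w w' v : dot (w + w') v = dot w v + dot w' v.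
Proof. by rewrite /dot mulmxDl mxE. Qed.

Lemma dotZl k w v : dot (k *: w) v = k * dot w v.
Proof. by rewrite /dot -scalemxAl mxE. Qed.

Lemma dot_sumr w (I : finType) (A : pred I) (u : I -> 'rV[K]_n) :
  dot w (\sum_(i in A) u i) = \sum_(i in A) dot w (u i).
Proof. by rewrite /dot raddf_sum /= mulmx_sumr summxE. Qed.

Lemma dotZr k w v : dot w (k *: v) = k * dot w v.
Proof. by rewrite /dot linearZ /= -scalemxAr mxE. Qed.

(** The map x - projv U x kills [U] but not [v]. A coordinate of it that is nonzero at [v],
    rescaled, is the form sought; [w] lists its values on the unit vectors. *)
Lemma separating_form (U : {vspace 'rV[K]_n}) (v : 'rV[K]_n) :
  v \notin U -> exists2 w, dot w v = 1 & forall u, u \in U -> dot w u = 0.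
Proof.
move=> vU; pose f x := x - projv U x.
have fv0 : f v != 0.
  by apply: contra vU; rewrite subr_eq0 => /eqP->; exact: memv_proj.
have /rV0Pn[j fj] := fv0.
pose w0 : 'rV[K]_n := \row_i (f (delta_mx 0 i)) 0 j.
have dotw0 x : dot w0 x = f x 0 j.
  rewrite {2}[x]row_sum_delta /f linear_sum -sumrB summxE /dot mxE.
  by apply: eq_bigr => i _; rewrite linearZ -scalerBr !mxE mulrC.
exists ((f v 0 j)^-1 *: w0) => [|u uU]; rewrite dotZl dotw0.
  by rewrite mulVf.
have fu : f u = 0 by rewrite /f projv_id ?subrr.
by rewrite fu [(0 : 'rV_n) 0 j]mxE mulr0.
Qed.

Let law (_ : 'rV[K]_n) : R := (#|{: 'rV[K]_n}|%:R)^-1.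

Lemma uniform_law_sum1 : \sum_w law w = 1.
Proof.
rewrite sumr_const -[_ *+ _]mulr_natr mulVf // pnatr_eq0 -lt0n.
by apply/card_gt0P; exists 0.
Qed.

(* Translations by multiples of w permute the values of [dot _ v] and preserve
   both E and the uniform law. *)
Lemma prob_value_invariant (E : pred 'rV[K]_n) w v a :
  dot w v = 1 -> (forall k r, E (r + k *: w) = E r) ->
  prob law (fun r => (dot r v == a) && E r) *+ #|K| = prob law E.
Proof.
move=> wv Einv; rewrite /prob [RHS](partition_big (dot^~ v) predT) //=.
rewrite -sumr_const; apply: eq_bigr => c _.
rewrite (reindex_inj (addIr ((a - c) *: w))) /=.
apply: eq_bigl => r; rewrite Einv dotDl dotZl wv mulr1 andbC; congr (_ && _).
by rewrite -[X in _ == X](subrK c a) addrC (inj_eq (addrI _)).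
Qed.

(** With no event to preserve, all [#|K|] values of [dot r v] are equally likely. *)
Lemma prob_value_gt0 v a : v != 0 -> 0 < prob law (fun r => dot r v == a).
Proof.
move=> v0; have [w wv _] : exists2 w, dot w v = 1 & forall u, u \in 0%VS -> dot w u = 0.
  by apply: separating_form; rewrite memv0.
have := @prob_value_invariant predT w v a wv (fun _ _ => erefl).
have -> : prob law predT = 1 by exact: uniform_law_sum1.
move=> h1; rewrite -(pmulrn_lgt0 _ (ltnW (finNzRing_gt1 K))).
rewrite (_ : _ *+ _ = 1) ?ltr01 // -h1; congr (_ *+ _).
by apply: eq_bigl => r; rewrite andbT.
Qed.

Hypothesis s_neq0 : s != 0.
Hypothesis e_neq0 : forall p, e p != 0.

Lemma uniform_law_ge0 w : 0 <= law w.
Proof. by rewrite invr_ge0 ler0n. Qed.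

Definition linear_scheme : sharing_scheme R P :=
  @SharingScheme R P 'rV[K]_n law K (fun=> K) (dot^~ s) (fun p => dot^~ (e p))
    uniform_law_ge0 uniform_law_sum1 (finNzRing_gt1 K)
    (fun a => prob_value_gt0 a s_neq0) (fun p b => prob_value_gt0 b (e_neq0 p)).

(** A combination of the vectors of [A] equal to [s] recovers the secret from the shares. If there
    is none, translations along a vector [w] orthogonal to those of [A] keep the shares and make all
    secrets equally likely. *)
Lemma linear_scheme_ideal (Gamma : {set P} -> Prop) :
  (forall A, Gamma A <-> s \in (\sum_(p in A) <[e p]>)%VS) -> ideal_access R Gamma.
Proof.
move=> GammaP; exists linear_scheme; split; last by [].
split=> A.
  move=> /GammaP/memv_sumP[u uP su] w w' _ _ eq_sh /=.
  rewrite {1 2}su !dot_sumr; apply: eq_bigr => p pA.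
  by have /vlineP[k ->] := uP p pA; rewrite !dotZr; congr (_ * _); exact: eq_sh.
move=> nA; have /separating_form[w ws wA] : s \notin (\sum_(p in A) <[e p]>)%VS.
  by apply/negP => /GammaP.
have we p : p \in A -> dot w (e p) = 0.
  by move=> pA; apply: wA; apply: (subvP (sumv_sup p pA (subvv _))); exact: memv_line.
move=> a b /=.
pose E r := [forall p in A, dot r (e p) == b p].
have Einv k r : E (r + k *: w) = E r.
  apply: eq_forallb => p; case: (boolP (p \in A)) => //= pA.
  by rewrite dotDl dotZl we // mulr0 addr0.
have hE := @prob_value_invariant E w s a ws Einv.
have hT := @prob_value_invariant predT w s a ws (fun _ _ => erefl).
(* The factor [#|K|] from [hE] is moved to the probability of the secret value, which it turns into
   1. *)
rewrite -[X in _ = _ * X]hE mulrnAr -mulrnAl.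
have -> : prob law (fun r => dot r s == a) *+ #|K| = 1.
  rewrite -uniform_law_sum1 -[RHS]hT; congr (_ *+ _); apply: eq_bigl => r; by rewrite andbT.
by rewrite mul1r.
Qed.
End Scheme.

(** * Authorized coalitions and linear spans *)

(** Induction on the size of [B]: remove [p], thin out the rest, and put [p] back exactly when its
    vector is outside the span. *)
Lemma independent_spanning_subset (K : fieldType) (vT : vectType K) (P : finType)
    (e : P -> vT) (B : {set P}) :
  exists2 B' : {set P}, B' \subset B &
    (\sum_(p in B') <[e p]> = \sum_(p in B) <[e p]>)%VS /\
    \dim (\sum_(p in B') <[e p]>)%VS = #|B'|.
Proof.
have [k] := ubnP #|B|; elim: k B => // k IHk B ltk.
have [->|[p pB]] := set_0Vmem B.
  by exists set0 => //; rewrite big_set0 dimv0 cards0.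
have [] := IHk (B :\ p); first by rewrite (cardsD1 p) pB in ltk.
move=> B' sB' [eB' dB']; have sB'B := subset_trans sB' (subD1set _ _).
rewrite (big_setD1 p pB) /= -eB'.
have [ep|ep] := boolP (e p \in \sum_(q in B') <[e q]>)%VS.
  by exists B' => //; split=> //; symmetry; apply/addv_idPr; rewrite -memvE.
have pB' : p \notin B'.
  by apply/negP => /(subsetP sB'); rewrite !inE eqxx.
exists (p |: B'); first by rewrite subUset sub1set pB.
rewrite big_setU1 //=; split=> //; rewrite cardsU1 pB' -dB' add1n.
apply/eqP; rewrite eqn_leq (leq_trans (dimv_add_leqif _ _)) /=; last first.
  by rewrite dim_vline -add1n leq_add2r leq_b1.
by rewrite (ltn_leqif (dimv_leqif_sup (addvSr _ _))) subv_add subvv andbT -memvE.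
Qed.

Section Access.
Variables (K : fieldType) (vT : vectType K) (J P : finType).
Variables (Pi : J -> {set P}) (blk : P -> J).
Hypothesis blkP : forall x p, (p \in Pi x) = (blk p == x).

Lemma card_blocks (A : {set P}) (Y : {set J}) :
  #|[set p in A | blk p \in Y]| = (\sum_(x in Y) #|A :&: Pi x|)%N.
Proof.
rewrite -sum1_card (partition_big blk [in Y]) /=; last by move=> p; rewrite inE => /andP[].
apply: eq_bigr => x xY; rewrite -sum1_card; apply: eq_bigl => p.
by rewrite !inE blkP -andbA; case: eqP => [->|_]; rewrite ?xY ?andbT ?andbF.
Qed.

Variables (h : {set J} -> nat) (Delta : {set {set J}}).
Variables (V : J -> {vspace vT}) (e : P -> vT) (s : vT).
Hypothesis h_mono : forall X Y : {set J}, X \subset Y -> (h X <= h Y)%N.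
Hypothesis dimV : forall Y : {set J}, \dim (\sum_(x in Y) V x)%VS = h Y.
Hypothesis sV : forall Y : {set J}, (s \in \sum_(x in Y) V x)%VS = (Y \in Delta).
Hypothesis eV : forall p, e p \in V (blk p).
Hypothesis e_generic : forall (S : {set P}) (U : {vspace vT}),
  U = 0%VS \/ U = <[s]>%VS ->
  exists Z : {set J}, \dim (U + \sum_(p in S) <[e p]>)%VS =
    (\dim (\sum_(x in Z) V x + U)%VS + #|[set p in S | blk p \notin Z]|)%N.

Let E (S : {set P}) : {vspace vT} := (\sum_(p in S) <[e p]>)%VS.

Lemma span_block_sub (S : {set P}) (Y : {set J}) :
  (forall p, p \in S -> blk p \in Y) -> (E S <= \sum_(x in Y) V x)%VS.
Proof.
move=> SY; apply/subv_sumP => p pS; rewrite -memvE.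
exact: (subvP (sumv_sup _ (SY p pS) (subvv _))).
Qed.

Lemma span_subset (S S' : {set P}) : S \subset S' -> (E S <= E S')%VS.
Proof.
move=> /subsetP sS; apply/subv_sumP => p pS.
by apply: (sumv_sup p) => //; exact: sS.
Qed.

Lemma span_split_le (S : {set P}) (Y : {set J}) :
  (\dim (E S) <=
   \dim (E [set p in S | blk p \in Y]) + #|[set p in S | blk p \notin Y]|)%N.
Proof.
rewrite /E (big_setID [set p | blk p \in Y]) /=.
rewrite -setIdE; apply: leq_trans (dimv_add_leqif _ _) _.
rewrite leq_add2l; apply: leq_trans (dim_sum_lines _ _) _.
by apply: subset_leq_card; apply/subsetP=> p; rewrite !inE andbC.
Qed.

Lemma access_span (A : {set P}) :
  access_structure Pi h Delta A <-> s \in E A.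
Proof.
split=> [[X [v [XD [vsupp vX vY] vA]]]|sA].
  pose B := [set p in A | blk p \in X].
  have sBV : (E B <= \sum_(x in X) V x)%VS.
    by apply: span_block_sub => p; rewrite inE => /andP[].
  suff /eqP EB : E B == (\sum_(x in X) V x)%VS.
    apply: (subvP (span_subset _ : E B <= E A)%VS); last by rewrite EB sV.
    by apply/subsetP=> p; rewrite inE => /andP[].
  rewrite eqEdim sBV dimV /=.
  (* The dimension of [E B] is h(Z) plus the number of participants of [A] in X \ Z, hence at least
     v(X :&: Z) + v(X \ Z) = h(X). *)
  have [Z] := e_generic B (or_introl erefl).
  rewrite add0v addv0 dimV -/(E B) => ->.
  have -> : [set p in B | blk p \notin Z] = [set p in A | blk p \in X :\: Z].
    by apply/setP=> p; rewrite !inE -andbA [X in _ && X]andbC.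
  rewrite card_blocks.
  have wX : vweight v X = h X.
    rewrite -vX /vweight [RHS](bigID [in X]) /= [X in (_ + X)%N]big1.
      by rewrite addn0; apply: eq_bigl => x; rewrite inE.
    move=> x /andP[_ xX]; apply/eqP; apply: contraNT xX => vx.
    by apply: (subsetP vsupp); rewrite inE.
  rewrite -wX /vweight (big_setID Z) /=; apply: leq_add.
    apply: leq_trans (vY (X :&: Z) (subsetIl _ _)) _.
    by apply: h_mono; exact: subsetIr.
  by apply: leq_sum => x _; have := vA x; rewrite ffunE.
have [Z dZ] := e_generic A (or_intror erefl).
pose B := [set p in A | blk p \in Z].
have sBV : (E B <= \sum_(x in Z) V x)%VS.
  by apply: span_block_sub => p; rewrite inE => /andP[].
have sA' : (<[s]> <= E A)%VS by rewrite -memvE.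
move: dZ; rewrite -/(E A) (addv_idPr sA') => dZ.
(* The participants outside [Z] add at most their number to [E B]. So [E B], the sum of the [V x]
   over [Z], and that sum with [s] all have the same dimension and coincide. *)
have leB : (\dim (\sum_(x in Z) V x + <[s]>) <= \dim (E B))%N.
  by rewrite -(leq_add2r #|[set p in A | blk p \notin Z]|) -dZ span_split_le.
have EB : E B = (\sum_(x in Z) V x)%VS.
  by apply/eqP; rewrite eqEdim sBV (leq_trans _ leB) // dimvS // addvSl.
have sZ : s \in (\sum_(x in Z) V x)%VS.
  have : (\sum_(x in Z) V x == \sum_(x in Z) V x + <[s]>)%VS.
    by rewrite eqEdim addvSl -{2}EB.
  by move=> /eqP->; apply: (subvP (addvSr _ _)); exact: memv_line.
(* The block profile of a basis of [E B] chosen among its participants is the required vector. *)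
have [B' sB' [EB' dB']] := independent_spanning_subset e B.
rewrite -/(E B') -/(E B) in EB' dB'.
exists Z, [ffun x => #|B' :&: Pi x|].
have B'Z p : p \in B' -> blk p \in Z by move=> /(subsetP sB'); rewrite inE => /andP[].
have wB (Y : {set J}) : vweight [ffun x => #|B' :&: Pi x|] Y =
    #|[set p in B' | blk p \in Y]|.
  by rewrite card_blocks; apply: eq_bigr => x _; rewrite ffunE.
split; first by rewrite -sV.
  split.
  - apply/subsetP=> x; rewrite !inE ffunE -lt0n => /card_gt0P[p].
    by rewrite inE blkP => /andP[pB /eqP <-]; exact: B'Z.
  - rewrite wB -dimV -EB -EB' dB'; congr #|pred_of_set _|.
    by apply/setP=> p; rewrite !inE andbT.
  move=> Y sYZ; rewrite wB -dimV.
  (* Part of an independent family is independent. *)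
  have -> : #|[set p in B' | blk p \in Y]| = \dim (E [set p in B' | blk p \in Y]).
    apply/eqP; rewrite eqn_leq dim_sum_lines andbT.
    rewrite -(leq_add2r #|[set p in B' | blk p \notin Y]|).
    apply: leq_trans (span_split_le _ _); rewrite dB'.
    rewrite -(cardsID [set p | blk p \in Y] B') leq_add // subset_leq_card //.
      by apply/subsetP=> p; rewrite !inE.
    by apply/subsetP=> p; rewrite !inE andbC.
  by apply: dimvS; apply: span_block_sub => p; rewrite inE => /andP[].
move=> x; rewrite !ffunE subset_leq_card // setSI //.
by apply: subset_trans sB' _; apply/subsetP=> p; rewrite inE => /andP[].
Qed.
End Access.

(** * Rank and increments of a uniform polymatroid *)

Section Uniform.
Variables (J : finType) (h : {set J} -> nat) (g : nat -> nat).
Hypothesis hZ : uniform_polymatroid h g.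

Lemma uniform_rank_step (Y : {set J}) x :
  x \notin Y -> h (x |: Y) = (h Y + g #|Y|)%N.
Proof.
case: hZ => [[_ h_mono _] _ [hg _] _] xY.
have cY : #|x |: Y| = #|Y|.+1 by rewrite cardsU1 xY.
by rewrite (hg _ Y (x |: Y) erefl cY) subnKC // h_mono // subsetUr.
Qed.

Lemma uniform_rank_sum (Y : {set J}) : h Y = (\sum_(i < #|Y|) g i)%N.
Proof.
have [k] := ubnP #|Y|; elim: k Y => // k IHk Y.
have [->|[x xY]] := set_0Vmem Y; first by case: hZ => [[-> _ _] _ _ _]; rewrite cards0 big_ord0.
rewrite -(setD1K xY) uniform_rank_step ?inE ?eqxx // (cardsU1 x) !inE eqxx /= add1n => ltk.
by rewrite big_ord_recr /= -IHk.
Qed.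

(** Submodularity at [x |: Y] and [y |: Y] with [#|Y|] = j gives g_(j+1) <= g_j. *)
Lemma increment_noninc i j : (i <= j < #|J|)%N -> (g j <= g i)%N.
Proof.
case/andP; elim: j => [|j IHj]; first by rewrite leqn0 => /eqP->.
rewrite leq_eqVlt => /predU1P[->//|]; rewrite ltnS => ij ltj.
apply: leq_trans (IHj ij (ltnW ltj)).
pose W := [set x in take j.+2 (enum J)].
have cW : #|W| = j.+2.
  rewrite cardsE; have /card_uniqP-> := take_uniq j.+2 (enum_uniq J).
  by rewrite size_takel // -cardE.
have /card_gt0P[x xW] : (0 < #|W|)%N by rewrite cW.
have cWx : #|W :\ x| = j.+1 by move: cW; rewrite (cardsD1 x) xW => -[].
have /card_gt0P[y yW] : (0 < #|W :\ x|)%N by rewrite cWx.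
pose Y := W :\ x :\ y.
have cY : #|Y| = j by move: cWx; rewrite (cardsD1 y) yW => -[].
have yY : y \notin Y by rewrite !inE eqxx.
have xY : x \notin Y by rewrite !inE eqxx andbF.
have nxy : x != y by move: yW; rewrite !inE eq_sym => /andP[].
case: hZ => [[_ _ /(_ (x |: Y) (y |: Y)) sub] _ _ _]; move: sub.
have -> : (x |: Y) :&: (y |: Y) = Y.
  rewrite -setUIl; apply/setUidPr; apply/subsetP=> z; rewrite !inE => /andP[/eqP->].
  by rewrite (negbTE nxy).
have -> : (x |: Y) :|: (y |: Y) = x |: (y |: Y).
  by rewrite -setUA [Y :|: _]setUCA setUid.
have xyY : x \notin y |: Y by rewrite in_setU1 negb_or nxy.
rewrite (uniform_rank_step xyY) (uniform_rank_step yY) (uniform_rank_step xY).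
rewrite cardsU1 yY cY add1n (addnA (h Y)) (addnC (h Y) (h Y + g j)) -addnA.
by rewrite !leq_add2l.
Qed.

End Uniform.

(** * The least member of [Delta] and the block map *)

(** Every member of [Delta] contains a minimal one, and only one exists. *)
Lemma min_family_singleton (J : finType) (Delta : {set {set J}}) :
  monotone_increasing Delta -> #|min_family Delta| = 1%N ->
  exists X0 : {set J}, forall X : {set J}, (X \in Delta) = (X0 \subset X).
Proof.
move=> [_ mono] /eqP/cards1P[X0 eX0]; exists X0 => X.
have /minsetP[X0D _] : minset [in Delta] X0.
  by have := set11 X0; rewrite -eX0 inE.
apply/idP/idP=> [XD|]; last exact: mono X0D.
have [Y minY sYX] := minset_exists XD.
by suff /set1P <- : Y \in [set X0] by []; rewrite -eX0 inE.
Qed.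

Lemma block_map (J P : finType) (Pi : J -> {set P}) : block_partition Pi ->
  exists blk : P -> J, forall x p, (p \in Pi x) = (blk p == x).
Proof.
move=> [_ disj cover].
have inPi p : exists x, p \in Pi x.
  by have := in_setT p; rewrite -cover => /bigcupP[x _ px]; exists x.
exists (fun p => xchoose (inPi p)) => x p.
apply/idP/eqP=> [px|<-]; last exact: (xchooseP (inPi p)).
apply/eqP; apply: contraTT px => /disj; rewrite disjoint_sym => dxy.
by rewrite (disjointFl dxy) // (xchooseP (inPi p)).
Qed.

Local Open Scope nat_scope.

(** * Assembly of the scheme *)

Theorem theorem5p2 (R : realType) (J : finType) (hJ : 2 <= #|J|)
    (h : {set J} -> nat) (g : nat -> nat) (hZ : uniform_polymatroid h g)
    (hg : 0 < g (#|J| - 1)) :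
  forall (P : finType) (Pi : J -> {set P}) (Delta : {set {set J}}),
    block_partition Pi ->
    (forall x : J, g 0 < #|Pi x|) ->
    monotone_increasing Delta ->
    Delta \proper powerset [set: J] ->
    #|min_family Delta| = 1 ->
    ideal_access R (access_structure Pi h Delta).
Proof.
move=> P Pi Delta partPi _ monoD properD minD.
have [X0 DX0] := min_family_singleton monoD minD.
have [blk blkP] := block_map partPi.
(* The field must hold [#|J|] distinct points and exceed the number of subspaces to avoid; [bool]
   selects whether [s] is adjoined. *)
have [p_ ltp p_pr] := prime_above (maxn #|J| #|{: {set J} * {set P} * bool}|).
have cK : #|'F_p_| = p_ by exact: card_Fp.
rewrite gtn_max -cK in ltp; have /andP[ltJ ltI] := ltp.
pose t (x : J) : 'F_p_ := enum_val (widen_ord (ltnW ltJ) (enum_rank x)).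
have t_inj : injective t.
  by move=> x y /enum_val_inj/(congr1 val)/=/val_inj/enum_rank_inj.
have g_mono := increment_noninc hZ.
rewrite subn1 in hg.
pose V := moment_space t g.
pose s := (\sum_(x in X0) moment_vector t g x 0)%R.
have dimV (Y : {set J}) : \dim (\sum_(x in Y) V x)%VS = h Y.
  by rewrite (uniform_rank_sum hZ) dim_moment_sum.
have sV (Y : {set J}) : (s \in \sum_(x in Y) V x)%VS = (Y \in Delta).
  by rewrite moment_sum_secret // DX0.
have [e [eV e_gen]] := generic_vectors blk V (fun b : bool => if b then <[s]>%VS else 0%VS) ltI.
have V_pos x : (0 < \dim (V x))%N.
  have -> : V x = (\sum_(y in [set x]) V y)%VS by rewrite big_set1.
  rewrite dimV (uniform_rank_sum hZ) cards1 big_ord1.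
  by case: hZ.
(* If [s] were 0, every subset of [J] would be in [Delta], against properness. *)
have s_neq0 : s != 0%R.
  apply: contraTneq properD => s0; rewrite properEneq negb_and negbK; apply/orP; left.
  apply/eqP/setP=> Y; rewrite powersetE subsetT -sV s0; exact: mem0v.
(* If [e p] were 0, the formula for the singleton of [p] would give a [Z] containing [blk p] whose
   span is 0, while [V (blk p)] has dimension g_0 > 0. *)
have e_neq0 p : e p != 0%R.
  have [Z _] := e_gen [set p] set0 false.
  rewrite big_set1 big_set0 !add0v addv0 dim_vline => eZ.
  apply/eqP => ep; move: eZ; rewrite ep eqxx /= => /esym/eqP.
  rewrite addn_eq0 cards_eq0 => /andP[dZ0 /eqP/setP/(_ p)].
  rewrite !inE eqxx /= => /negbFE pZ.
  have sVZ : (V (blk p) <= \sum_(x in Z) V x)%VS by exact: sumv_sup pZ (subvv _).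
  by have := leq_trans (V_pos (blk p)) (dimvS sVZ); rewrite (eqP dZ0).
apply: (@linear_scheme_ideal R _ _ P e s s_neq0 e_neq0) => A.
apply: (access_span blkP) => //; first by case: hZ => [[]].
move=> S U [] ->.
  have [Z _] := e_gen S set0 false.
  by rewrite big_set0 !add0v; exists Z.
have [Z _] := e_gen S set0 true.
by rewrite big_set0 !add0v; exists Z.
Qed.
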